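(* Let $s\ge 1$, $n\ge 1$ and $k\ge s+1$ be integers. Then the total number of occurrences of the string $a(a+s)$ in all the members of $\mathcal{A}_{n,k}$ is $k^{n-2}(k-s)(n-1)$.
   Context: $\mathcal{A}_{n,k}=[k]^n$ denotes the set of $k$-ary words $\rho=\rho_1\cdots\rho_n$ of length $n$ with letters in $[k]=\{1,\dots,k\}$. An occurrence of the string $a(a+s)$ in $\rho$ is an index $i\in\{1,\dots,n-1\}$ with $\rho_{i+1}-\rho_i=s$. The total is the sum over all $\rho\in\mathcal{A}_{n,k}$ of the number of occurrences in $\rho$. *)

(* Defs.v *)
From mathcomp Require Import all_boot all_order all_algebra.

Set Implicit Arguments.
Unset Strict Implicit.
Unset Printing Implicit Defensive.

Import GRing.Theory.
Local Open Scope ring_scope.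

Notation word n k := (n.-tuple 'I_k).

(* The ordinal a : 'I_k (0 <= a < k) stands for the letter a + 1 of
   [k] = {1, ..., k}. *)
Definition letters (n k : nat) (rho : word n k) : seq int :=
  [seq (a.+1)%:Z | a : 'I_k <- rho].

(* Indices are 0-based: i ranges over 0, ..., n-2, so both i and i.+1 are
   positions of rho and the default value of nth is never used. *)
Definition occurrences (s n k : nat) (rho : word n k) : nat :=
  #|[set i : 'I_n.-1 | (letters rho)`_i.+1 - (letters rho)`_i == s%:Z]|.

Definition total_occurrences (s n k : nat) : nat :=
  (\sum_(rho : word n k) occurrences s rho)%N.

(* Main.v *)
Require Import Defs.
From mathcomp Require Import all_boot all_order all_algebra.

Import GRing.Theory.
Local Open Scope ring_scope.

(** By exchanging sums, the total is a sum over the [n - 1] positions [i] of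
    the number of words with an occurrence at [i].  This number does not depend
    on [i]: an occurrence at [i] constrains only the two letters in positions
    [i] and [i + 1], and the other [n - 2] letters are free
    ([card_word_rel2]).  The two letters form a pair [(a, a + s)], and there
    are [k - s] such pairs ([card_shift_pairs]).  For [n = 1] there are no
    positions, and both sides vanish. *)

(** Through the bijection between words and functions on positions, the words
    with two letters prescribed are a product of singletons (at [i] and [j])
    and copies of [T] (elsewhere). *)
Lemma card_word_letters2 (T : finType) n (i j : 'I_n) (a b : T) : i != j ->
  #|[set rho : n.-tuple T | (tnth rho i == a) && (tnth rho j == b)]|
    = (#|T| ^ (n - 2))%N.
Proof.
move=> neq_ij.
pose F x : pred T := if x == i then pred1 a else if x == j then pred1 b else T.
rewrite -[LHS](card_imset _ (can_inj (@finfun_of_tupleK _ _))).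
have -> : #|[set finfun_of_tuple rho | rho : n.-tuple T in
     [set rho : n.-tuple T | (tnth rho i == a) && (tnth rho j == b)]]|
     = #|family F|.
  apply: eq_card => f; apply/imsetP/familyP => [[rho] | fF].
    rewrite inE => /andP[rho_i rho_j] -> x.
    by rewrite /F ffunE; case: eqP => [-> | _] //; case: eqP => [-> | _].
  exists (tuple_of_finfun f); last by rewrite tuple_of_finfunK.
  have := fF i; have := fF j; rewrite /F !eqxx eq_sym (negPf neq_ij).
  by rewrite inE !tnth_mktuple => fj fi; apply/andP; split.
rewrite card_family foldrE big_map big_enum /=.
rewrite (bigD1 i) //= (bigD1 j) 1?eq_sym //=.
rewrite /F !eqxx eq_sym (negPf neq_ij) !card1 !mul1n.
under eq_bigr => x /andP[/negPf -> /negPf ->] do [].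
rewrite prod_nat_const; congr (_ ^ _)%N.
have -> : #|(fun x => (x != i) && (x != j))| = #|~: [set i; j]|.
  by apply: eq_card => x; rewrite !inE negb_or.
by rewrite cardsCs setCK cards2 neq_ij card_ord.
Qed.

Lemma card_word_rel2 (T : finType) n (i j : 'I_n) (R : rel T) : i != j ->
  #|[set rho : n.-tuple T | R (tnth rho i) (tnth rho j)]|
    = (#|[set p : T * T | R p.1 p.2]| * #|T| ^ (n - 2))%N.
Proof.
move=> neq_ij; rewrite -sum1_card.
rewrite (partition_big (fun rho => (tnth rho i, tnth rho j))
  [in [set p : T * T | R p.1 p.2]]) => [|rho]; last by rewrite !inE.
rewrite -sum_nat_const; apply: eq_bigr => -[a b]; rewrite inE /= => Rab.
rewrite -(card_word_letters2 _ _ _ _ a b neq_ij) -sum1_card.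
apply: eq_bigl => rho; rewrite !inE xpair_eqE.
by case: eqP => [->|]; case: eqP => [->|] //=; rewrite ?Rab ?andbF.
Qed.

(** The pairs are [(a, a + s)], and [a + s] stays below [k] exactly when
    [a < k - s]; so they are the image of ['I_(k - s)] under an injection. *)
Lemma card_shift_pairs s k : (s <= k)%N ->
  #|[set p : 'I_k * 'I_k | p.2 == p.1 + s :> nat]%N| = (k - s)%N.
Proof.
move=> le_sk; rewrite -(subnK le_sk) addnK addnC; set m := (k - s)%N.
rewrite -[RHS]card_ord -(card_imset _
  (f := fun a : 'I_m => (cast_ord (addnC m s) (lshift s a), rshift s a))).
  apply: eq_card => -[a b]; rewrite inE /=.
  apply/eqP/imsetP => [eq_b | [c _ [-> ->]] /=]; last exact: addnC.
  have lt_am : (a < m)%N by rewrite -(ltn_add2l s) [ltnLHS]addnC -eq_b.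
  exists (Ordinal lt_am) => //.
  by congr (_, _); apply/val_inj; rewrite //= eq_b addnC.
by move=> a b [] /val_inj.
Qed.

(** The shift of letters from [0..k-1] to [1..k] cancels in the difference. *)
Lemma occurrenceE s n k (rho : word n.+1 k) (i : 'I_n) :
  ((letters rho)`_i.+1 - (letters rho)`_i == s%:Z)
    = (tnth rho (lift ord0 i) == tnth rho (widen_ord (leqnSn n) i) + s :> nat)%N.
Proof.
(* any letter of the nonempty word rho can serve as a default value *)
pose x0 := tnth rho ord0.
rewrite /letters !(nth_map x0) ?size_tuple ?ltnS ?(ltnW (ltn_ord i)) //.
rewrite !(tnth_nth x0) /= subr_eq addrC -PoszD eqz_nat.
by rewrite addSn eqSS.
Qed.

Lemma total_occurrencesE s n k : (s <= k)%N ->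
  total_occurrences s n k = (n.-1 * ((k - s) * k ^ (n - 2)))%N.
Proof.
move=> le_sk; case: n => [|n].
  by rewrite /total_occurrences big1 // => rho _; apply: eq_card0 => -[].
rewrite /total_occurrences /occurrences.
under eq_bigr => rho _ do rewrite -sum1dep_card big_mkcond.
rewrite exchange_big /=.
transitivity (\sum_(i < n) (k - s) * k ^ (n.+1 - 2))%N; last first.
  by rewrite sum_nat_const card_ord.
apply: eq_bigr => i _; rewrite -big_mkcond sum1dep_card.
have neq_i : widen_ord (leqnSn n) i != lift ord0 i.
  by rewrite -val_eqE /= neq_ltn leqnn.
have := card_word_rel2 _ _ _ _ (fun a b : 'I_k => b == a + s :> nat)%N neq_i.
rewrite card_shift_pairs // card_ord => <-.
by apply: eq_card => rho; rewrite !inE occurrenceE.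
Qed.

(* The identity is stated in rat because the exponent n - 2 is negative
   when n = 1. *)
Theorem corollary2p5 (s n k : nat)
  (hs : (1 <= s)%N) (hn : (1 <= n)%N) (hk : (s + 1 <= k)%N) :
  (total_occurrences s n k)%:R =
    (k%:R : rat) ^ (n%:Z - 2) * (k%:R - s%:R) * (n%:R - 1).
Proof.
have le_sk : (s <= k)%N by apply: leq_trans hk; apply: leq_addr.
rewrite total_occurrencesE //.
case: n hn => [|[|n]] // _; first by rewrite mul0n subrr mulr0.
rewrite -[n.+2]addn2 PoszD addrK addnK addn2 /= -exprnP.
by rewrite !natrM natrB // natrX -[n.+2]addn1 natrD addrK mulrC [_ * _ ^+ n]mulrC.
Qed.
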